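(* Let $P\subset M_{\mathbb{R}}$ be a smooth lattice polytope. Then its barycentric hull $\mathsf{B}(P)$ is the convex hull of the barycenters of the corners of $P$. Furthermore: (1) If $P$ is a unimodular simplex, then $\mathsf{B}(P)$ is a point. (2) If $P$ is not a unimodular simplex, then the function $\mathcal{C}\colon\operatorname{Verts}(P)\to\operatorname{Verts}(\mathsf{B}(P))$, $v\mapsto\mathcal{C}(v)$, is a bijection (in particular each $\mathcal{C}(v)$ is a vertex of $\mathsf{B}(P)$), and whenever $v,w$ are vertices of $P$ joined by an edge, $\mathcal{C}(v)$ and $\mathcal{C}(w)$ are joined by an edge of $\mathsf{B}(P)$ and the edge between $v$ and $w$ is parallel to the edge between $\mathcal{C}(v)$ and $\mathcal{C}(w)$. As a consequence, $P$ and $\mathsf{B}(P)$ have the same collection of feasible cones; more precisely, $$\operatorname{fcone}(P,v)=\operatorname{fcone}(\mathsf{B}(P),\mathcal{C}(v))\quad\text{for every vertex } v \text{ of } P.$$ In particular, $\mathsf{B}(P)$ is a smooth polytope.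
   Context: $M$ is a free abelian group of finite rank $d$, $M_{\mathbb{R}}=M\otimes_{\mathbb{Z}}\mathbb{R}$. A lattice polytope is a convex polytope in $M_{\mathbb{R}}$ whose vertices all lie in $M$. $\operatorname{Verts}(Q)$ denotes the set of vertices of a polytope $Q$. For a polytope $Q$ and a vertex $v$ of $Q$, the feasible cone is $\operatorname{fcone}(Q,v)=\operatorname{Cone}\{x-v\mid x\in Q\}$. A full-dimensional polytope $Q$ is smooth if its normal fan is regular, i.e. $\operatorname{fcone}(Q,v)$ is regular (generated by a part of a $\mathbb{Z}$-basis of $M$) for every vertex $v$ of $Q$. A $d$-simplex is unimodular if it is the image of the standard simplex $\operatorname{Conv}(0,e_1,\dots,e_d)$ ($e_1,\dots,e_d$ a $\mathbb{Z}$-basis of $M\cong\mathbb{Z}^d$) under a map $x\mapsto Ax+b$ with $A$ an integer matrix of determinant $\pm1$ and $b$ an integer vector. The barycenter of a polytope with vertices $v_1,\dots,v_m$ is $\frac1m\sum_i v_i$. The barycentric hull $\mathsf{B}(P)$ of a lattice $d$-polytope $P$ is the convex hull of the barycenters of all $d$-simplices with vertices in $P\cap M$. A corner of a smooth $d$-polytope $P$ is the unimodular simplex obtained as the convex hull of lattice points $v_0,v_1,\dots,v_d\in P\cap M$, where $v_0$ is a vertex of $P$ and $v_1,\dots,v_d$ are the nearest lattice points to $v_0$ (different from $v_0$) lying on the $d$ edges of $P$ adjacent to $v_0$; this is the corner associated to $v_0$. $\mathcal{C}(v)$ denotes the barycenter of the corner associated to the vertex $v$ of $P$. *)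

(* Defs.v *)
From HB Require Import structures.
From mathcomp Require Import all_boot all_order all_algebra finmap.
From mathcomp Require Import all_classical all_reals all_analysis.

Set Implicit Arguments.
Unset Strict Implicit.
Unset Printing Implicit Defensive.

Import Order.TTheory GRing.Theory Num.Theory numFieldNormedType.Exports.

Local Open Scope classical_set_scope.
Local Open Scope ring_scope.

(* A Z-basis of M is fixed: M is 'rV[int]_d, M_R is 'rV[R]_d, and M is embedded
   in M_R by coercing the coordinates. Matrices act on row vectors on the right. *)

Section Convexity.
Variables (R : realType) (d : nat).
Local Notation V := 'rV[R]_d.
Implicit Types (A Q F E : set V) (v w : V).

Definition conv_hull A : set V :=
  [set y | exists n (a : 'I_n -> R) (x : 'I_n -> V),
     [/\ forall i, 0 <= a i, \sum_i a i = 1, forall i, A (x i)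
       & y = \sum_i a i *: x i]].

Definition cone A : set V :=
  [set y | exists n (a : 'I_n -> R) (x : 'I_n -> V),
     [/\ forall i, 0 <= a i, forall i, A (x i) & y = \sum_i a i *: x i]].

Definition diffs k (p : 'I_k.+1 -> V) : 'M[R]_(k, d) :=
  \matrix_(i < k) (p (lift ord0 i) - p ord0).

Definition affinely_independent k (p : 'I_k.+1 -> V) : Prop :=
  row_free (diffs p).

(* The affine hull of A has dimension k: it is spanned by k+1 affinely
   independent points of A. The empty set has no dimension. *)
Definition has_dim A k : Prop :=
  exists p : 'I_k.+1 -> V,
    [/\ forall i, A (p i), affinely_independent p
      & forall x, A x -> (x - p ord0 <= diffs p)%MS].

Definition polytope Q : Prop := exists2 A, finite_set A & Q = conv_hull A.

(* u is a linear form; u = 0 makes Q a face of itself. *)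
Definition face Q F : Prop :=
  exists u : 'cV[R]_d,
    F = [set x | Q x /\ forall y, Q y -> (x *m u) 0 0 <= (y *m u) 0 0].

Definition vertices Q : set V := [set v | face Q [set v]].

Definition edge Q E : Prop := face Q E /\ has_dim E 1.

Definition joined Q v w : Prop := edge Q (conv_hull [set v; w]).

Definition parallel (x y : V) : Prop := exists2 c : R, c != 0 & y = c *: x.

Definition fcone Q v : set V := cone [set x - v | x in Q].

(* Meaningful when Q has finitely many vertices. *)
Definition barycenter Q : V :=
  let vs := fset_set (vertices Q) in
  #|` vs|%:R^-1 *: \sum_(v <- vs) v.

Definition d_simplex Q : Prop :=
  exists2 p : 'I_d.+1 -> V, affinely_independent p & Q = conv_hull (range p).

End Convexity.

Section Lattice.
Variables (R : realType) (d : nat).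
Local Notation V := 'rV[R]_d.
Implicit Types (P Q S E C : set V) (v w : V).

Definition emb (m : 'rV[int]_d) : V := map_mx intr m.

Definition lattice : set V := range emb.

Definition Zbasis (b : 'I_d -> 'rV[int]_d) : Prop :=
  forall m : 'rV[int]_d, exists! c : 'rV[int]_d, m = \sum_i c 0 i *: b i.

Definition lattice_polytope P : Prop :=
  polytope P /\ vertices P `<=` lattice.

Definition regular_cone C : Prop :=
  exists (b : 'I_d -> 'rV[int]_d) (I : {set 'I_d}),
    Zbasis b /\ C = cone [set emb (b i) | i in [set i | i \in I]].

Definition smooth Q : Prop :=
  [/\ polytope Q, has_dim Q d
    & forall v, vertices Q v -> regular_cone (fcone Q v)].

Definition standard_simplex : set V :=
  conv_hull ([set 0] `|` [set delta_mx 0 i | i in [set: 'I_d]]).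

Definition unimodular_simplex Q : Prop :=
  exists (A : 'M[int]_d) (b : 'rV[int]_d),
    (\det A = 1 \/ \det A = -1) /\
    Q = [set x *m map_mx intr A + emb b | x in standard_simplex].

Definition barycentric_hull P : set V :=
  conv_hull [set barycenter S | S in
         [set S | d_simplex S /\ vertices S `<=` P `&` lattice]].

(* Used with E an edge and v one of its endpoints: the candidates w then lie on
   a ray issued from v, so every norm gives the same nearest point. *)
Definition nearest_lattice_point E v w : Prop :=
  [/\ E w, lattice w, w <> v
    & forall w', E w' -> lattice w' -> w' <> v -> `|w - v| <= `|w' - v|].

Definition corner P v : set V :=
  conv_hull ([set v] `|`
        [set w | exists E, [/\ edge P E, E v & nearest_lattice_point E v w]]).

Definition corner_barycenter P v : V := barycenter (corner P v).

End Lattice.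

(* Main.v *)
(* At a vertex v of P take the Z-basis b_1, ..., b_d generating fcone(P, v), and
   its dual basis. Each dual form is a nonnegative integer at x - v for every
   lattice point x of P, and is not identically zero on the vertices of a lattice
   d-simplex S; so it takes a value at least 1/(d+1) at the barycenter of S minus
   v, with equality when S is the corner at v. Hence all barycenters lie in
   C(v) + fcone(P, v), and a linear form minimal on P at v is minimal on the
   barycenters at C(v); by Farkas' lemma B(P) is the convex hull of the C(v).
   If w = v + t b_i is a vertex adjacent to v, then for j <> i the j-th dual form
   at v is also a dual form at w, as it defines a facet through both, so
   C(w) - C(v) = s b_i with s >= 0. If s = 0, the corner at w is all of P.
   Otherwise fcone(B(P), C(v)) contains every b_i, hence equals fcone(P, v). *)
Require Import Defs.
From HB Require Import structures.
From mathcomp Require Import all_boot all_order all_algebra finmap.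
From mathcomp Require Import all_classical all_reals all_analysis.
From mathcomp Require Import ring lra.
Import Order.TTheory GRing.Theory Num.Theory numFieldNormedType.Exports.
Local Open Scope classical_set_scope.
Local Open Scope ring_scope.

Set Implicit Arguments.
Unset Strict Implicit.
Unset Printing Implicit Defensive.

(** * Linear forms and Farkas' lemma *)

Section LinearForms.
Variables (R : realType) (d : nat).
Implicit Types (x y v w : 'rV[R]_d) (u : 'cV[R]_d).

Definition dot x u : R := (x *m u) 0 0.

Lemma dotDl x y u : dot (x + y) u = dot x u + dot y u.
Proof. by rewrite /dot mulmxDl mxE. Qed.

Lemma dotNl x u : dot (- x) u = - dot x u.
Proof. by rewrite /dot mulNmx mxE. Qed.

Lemma dotBl x y u : dot (x - y) u = dot x u - dot y u.
Proof. by rewrite dotDl dotNl. Qed.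

Lemma addrBl x y : x + y - x = y.
Proof. by rewrite addrC addKr. Qed.

Lemma dot_sub_shift x w v u : dot (x - w) u = dot (x - v) u - dot (w - v) u.
Proof. by rewrite -dotBl opprB addrA subrK. Qed.

Lemma dotZl a x u : dot (a *: x) u = a * dot x u.
Proof. by rewrite /dot -scalemxAl mxE. Qed.

Lemma dot_suml I (r : seq I) (Q : pred I) (F : I -> 'rV[R]_d) u :
  dot (\sum_(i <- r | Q i) F i) u = \sum_(i <- r | Q i) dot (F i) u.
Proof. by rewrite /dot mulmx_suml summxE. Qed.

Lemma dotDr x u (w : 'cV[R]_d) : dot x (u + w) = dot x u + dot x w.
Proof. by rewrite /dot mulmxDr mxE. Qed.

Lemma dotNr x u : dot x (- u) = - dot x u.
Proof. by rewrite /dot mulmxN mxE. Qed.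

Lemma dotZr a x u : dot x (a *: u) = a * dot x u.
Proof. by rewrite /dot -scalemxAr mxE. Qed.

Lemma dot_sumr I (r : seq I) (Q : pred I) (F : I -> 'cV[R]_d) x :
  dot x (\sum_(i <- r | Q i) F i) = \sum_(i <- r | Q i) dot x (F i).
Proof. by rewrite /dot mulmx_sumr summxE. Qed.

Lemma dot_delta x i : dot x (delta_mx i 0) = x 0 i.
Proof.
rewrite /dot mxE (bigD1 i) //= mxE !eqxx mulr1 big1 ?addr0 // => j ji.
by rewrite mxE (negbTE ji) mulr0.
Qed.

(* Bartl's argument: if dropping [a ord0] destroys the hypothesis, a witness
   [u0] of this lets one project everything along [u0] onto the kernel of
   [a ord0], where one generator fewer is needed. *)
Lemma farkas n (a : 'I_n -> 'rV[R]_d) (c : 'rV[R]_d) :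
    (forall u, (forall i, 0 <= dot (a i) u) -> 0 <= dot c u) ->
  exists l : 'I_n -> R, (forall i, 0 <= l i) /\ c = \sum_i l i *: a i.
Proof.
elim: n a c => [|n IH] a c H.
  exists (fun=> 0); split => //; rewrite big_ord0; apply/rowP => j.
  rewrite mxE -dot_delta; apply/eqP; rewrite eq_le -oppr_ge0 -dotNr.
  by rewrite !H //; case.
have [|/existsNP[u0 /not_implyP[au0 /negP]]] := pselect (forall u,
  (forall i, 0 <= dot (a (lift ord0 i)) u) -> 0 <= dot c u).
  move=> /IH[l [l0 ->]].
  exists (fun i => if unlift ord0 i is Some j then l j else 0); split.
    by move=> i; case: unliftP.
  rewrite big_ord_recl unlift_none scale0r add0r.
  by apply: eq_bigr => i _; rewrite liftK.
rewrite -ltNge => cu0.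
have a0u0 : dot (a ord0) u0 < 0.
  rewrite ltNge; apply: contraTN cu0 => h; rewrite -leNgt; apply: H => i.
  by case: (unliftP ord0 i) => [j ->|->].
set p := fun x => x - (dot x u0 / dot (a ord0) u0) *: a ord0.
have [u|l [l0 E]] := IH (fun i => p (a (lift ord0 i))) (p c).
  set u' := u - (dot (a ord0) u / dot (a ord0) u0) *: u0.
  have pE x : dot (p x) u = dot x u'.
    by rewrite /p /u' dotBl dotZl dotDr dotNr dotZr; ring.
  move=> h; rewrite pE; apply: H => i; case: (unliftP ord0 i) => [j ->|->].
    by rewrite -pE.
  by rewrite dotDr dotNr dotZr divfK ?subrr ?lt_eqF.
have {}E : c = (dot c u0 / dot (a ord0) u0
    - \sum_i l i * (dot (a (lift ord0 i)) u0 / dot (a ord0) u0)) *: a ord0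
    + \sum_i l i *: a (lift ord0 i).
  rewrite -[LHS](subrK ((dot c u0 / dot (a ord0) u0) *: a ord0)) -/(p c) E.
  have -> : \sum_i l i *: p (a (lift ord0 i)) = \sum_i l i *: a (lift ord0 i)
      - (\sum_i l i * (dot (a (lift ord0 i)) u0 / dot (a ord0) u0)) *: a ord0.
    rewrite scaler_suml -sumrB.
    by apply: eq_bigr => i _; rewrite scalerBr scalerA.
  by rewrite scalerBl addrC addrA addrAC.
exists (fun i => if unlift ord0 i is Some j then l j else
  dot c u0 / dot (a ord0) u0
    - \sum_j l j * (dot (a (lift ord0 j)) u0 / dot (a ord0) u0)); split.
  (* The coefficient of [a ord0] is nonnegative because [u0] is negative at [c] and at [a ord0] and
     nonnegative at the other generators. *)
  move=> i; case: unliftP => // _; rewrite subr_ge0.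
  apply: (@le_trans _ _ 0); last by rewrite nmulr_rge0 ?ltW ?invr_lt0.
  rewrite -oppr_ge0 -sumrN; apply: sumr_ge0 => j _.
  by rewrite -mulrN -mulrN mulr_ge0 // mulr_ge0 // oppr_ge0 invr_le0 ltW.
rewrite big_ord_recl unlift_none {1}E; congr (_ + _).
by apply: eq_bigr => i _; rewrite liftK.
Qed.

End LinearForms.

(** * Convex hulls, polytopes and their vertices *)

Section Hulls.
Variables (R : realType) (d : nat).
Implicit Types (A Q F E : set 'rV[R]_d) (x y v w : 'rV[R]_d) (u : 'cV[R]_d).

Lemma sub_conv_hull A : A `<=` conv_hull A.
Proof.
move=> x Ax; exists 1%N, (fun=> 1), (fun=> x); split => //.
  by rewrite big_ord1.
by rewrite big_ord1 scale1r.
Qed.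

Lemma conv_hull_mono A A' : A `<=` A' -> conv_hull A `<=` conv_hull A'.
Proof.
move=> sAA' _ [n [a [x [a0 a1 Ax ->]]]].
by exists n, a, x; split => // i; apply: sAA'.
Qed.

(** A convex combination averages the values of the form, so they cannot all exceed the average. *)
Lemma conv_hull_ge A y u :
  conv_hull A y -> exists2 x, A x & dot x u <= dot y u.
Proof.
move=> [n [a [x [a0 a1 Ax yE]]]]; apply: contrapT => no.
have gt i : dot y u < dot (x i) u.
  by rewrite ltNge; apply/negP => h; apply: no; exists (x i).
have s0 : \sum_i a i * (dot (x i) u - dot y u) = 0.
  under eq_bigr do rewrite mulrBr.
  rewrite sumrB -mulr_suml a1 mul1r yE dot_suml.
  by under [X in _ - X]eq_bigr do rewrite dotZl; rewrite subrr.
have : \sum_i a i = 0.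
  apply: big1 => i _; have /eqP := psumr_eq0P
    (fun j _ => mulr_ge0 (a0 j) (ltW (etrans (subr_gt0 _ _) (gt j)))) s0 (isT : xpredT i).
  by rewrite mulf_eq0 subr_eq0 (gt_eqF (gt i)) orbF => /eqP.
by rewrite a1 => /eqP; rewrite oner_eq0.
Qed.

(** Dual description of a finitely generated hull. Sufficiency is Farkas' lemma after homogenizing:
    with a coordinate 1 appended to every point, the last coordinate of the conic combination says
    that the weights sum to 1. *)
Lemma conv_hullP A y : finite_set A ->
  conv_hull A y <-> forall u, exists2 x, A x & dot x u <= dot y u.
Proof.
move=> /finite_seqP[s ->]; split=> [Hy u|H]; first exact: conv_hull_ge.
pose x (i : 'I_(size s)) := tnth (in_tuple s) i.
have [u Hu|l [l0 E]] := @farkas R (d + 1) (size s)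
  (fun i => row_mx (x i) 1) (row_mx y 1).
  have dE z : dot (row_mx z 1) u = dot z (usubmx u) + dot 1 (dsubmx u).
    by rewrite /dot -{1}(vsubmxK u) mul_row_col mxE.
  have [z /= zs zy] := H (usubmx u).
  have [i zE] : exists i, z = x i.
    have iz : (index z s < size s)%N by rewrite index_mem.
    by exists (Ordinal iz); rewrite /x (tnth_nth z) /= nth_index.
  by apply: le_trans (Hu i) _; rewrite !dE lerD2r -zE.
exists (size s), l, x; split => //.
- have := congr1 (fun z => rsubmx z 0 0) E.
  rewrite row_mxKr linear_sum /= summxE mxE eqxx mulr1n => ->.
  by apply: eq_bigr => i _; rewrite scale_row_mx row_mxKr !mxE eqxx mulr1.
- by move=> i /=; apply: mem_tnth.
- have := congr1 lsubmx E; rewrite row_mxKl linear_sum /= => ->.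
  by apply: eq_bigr => i _; rewrite scale_row_mx row_mxKl.
Qed.

(** In the dual description, for each form, the smaller of the witnesses for [x] and for [y] serves
    the combination. *)
Lemma polytope_convex Q x y (a b : R) : polytope Q -> Q x -> Q y ->
  0 <= a -> 0 <= b -> a + b = 1 -> Q (a *: x + b *: y).
Proof.
move=> [A finA ->] /conv_hullP-/(_ finA) hx /conv_hullP-/(_ finA) hy a0 b0 ab.
apply/conv_hullP => // u; have [p Ap px] := hx u; have [q Aq qy] := hy u.
have [|/ltW] := leP (dot p u) (dot q u) => pq; [exists p|exists q] => //;
  rewrite dotDl !dotZl -[X in X <= _]mul1r -ab mulrDl lerD //; apply: ler_wpM2l => //.
  exact: le_trans pq qy.
exact: le_trans pq px.
Qed.

Lemma vertex_sub Q v : vertices Q v -> Q v.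
Proof. by move=> [u e]; have: [set v] v by []; rewrite e => -[]. Qed.

Lemma vertices_conv_hull A : vertices (conv_hull A) `<=` A.
Proof.
move=> v [u e]; have: [set v] v by [].
rewrite {1}e => -[hv min]; have [x Ax xv] := conv_hull_ge u hv.
have : [set v] x.
  rewrite e; split; first exact: sub_conv_hull.
  by move=> y /min; apply: le_trans.
by move=> <-.
Qed.

Lemma expose_vertex Q v u :
  Q v -> (forall x, Q x -> x <> v -> dot v u < dot x u) -> vertices Q v.
Proof.
move=> Qv H; exists u; apply/seteqP; split => [_ ->|x [Qx min]] /=.
  split=> // y Qy; have [->//|/eqP] := eqVneq y v.
  by move=> /(H _ Qy)/ltW.
apply: contrapT => xv; have := H _ Qx xv; apply/negP; rewrite -leNgt; exact: min.
Qed.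

(** A combination of points of [A] at which the form does not exceed its strict minimum puts weight
    on [v] alone. *)
Lemma vertex_conv_hull A v u :
  A v -> (forall x, A x -> x <> v -> dot v u < dot x u) -> vertices (conv_hull A) v.
Proof.
move=> Av H; apply: (@expose_vertex _ _ u); first exact: sub_conv_hull.
move=> y [n [a [x [a0 a1 Ax ->]]]] yv; rewrite ltNge; apply/negP => le.
have ge i : 0 <= a i * (dot (x i) u - dot v u).
  rewrite mulr_ge0 // subr_ge0; have [->//|/eqP] := eqVneq (x i) v.
  by move=> /(H _ (Ax i))/ltW.
have s0 : \sum_i a i * (dot (x i) u - dot v u) = 0.
  apply/eqP; rewrite eq_le sumr_ge0 // andbT.
  under eq_bigr do rewrite mulrBr.
  rewrite sumrB -mulr_suml a1 mul1r subr_le0; apply: le_trans le.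
  by rewrite dot_suml; apply: ler_sum => i _; rewrite dotZl.
apply: yv; rewrite -[RHS]scale1r -a1 scaler_suml; apply: eq_bigr => i _.
have /eqP := psumr_eq0P (fun j _ => ge j) s0 (isT : xpredT i).
rewrite mulf_eq0 => /orP[/eqP->|]; first by rewrite !scale0r.
rewrite subr_eq0 => /eqP e; have [->//|/eqP/(H _ (Ax i))] := eqVneq (x i) v.
by rewrite e ltxx.
Qed.

(** In the dual description, a witness equal to [x] can be traded for one among the remaining
    points, since [x] lies in their hull. *)
Lemma conv_hull_redundant (s : seq 'rV[R]_d) x : conv_hull [set` rem x s] x ->
  conv_hull [set` s] = conv_hull [set` rem x s].
Proof.
move=> hx; apply/seteqP; split; last first.
  by apply: conv_hull_mono => z /=; apply: mem_rem.
move=> y /conv_hullP-/(_ (finite_seq _)) hy.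
apply/conv_hullP; first exact: finite_seq.
move=> u; have [z /= zs zy] := hy u.
have [zx|zx] := eqVneq z x; last first.
  exists z => //=; case: (boolP (x \in s)) => xs; last by rewrite rem_id.
  by move: zs; rewrite (perm_mem (perm_to_rem xs)) inE (negbTE zx).
have [w ws wx] := conv_hull_ge u hx; exists w => //.
by apply: le_trans wx _; rewrite -zx.
Qed.

(** Points lying in the hull of the others are discarded as long as there are any. For each point
    that remains, the dual description supplies a form strictly smaller there than at the others,
    which exposes it as a vertex. *)
Lemma polytope_vertices Q : polytope Q ->
  finite_set (vertices Q) /\ Q = conv_hull (vertices Q).
Proof.
move=> [_ /finite_seqP[s ->] ->]; have [n] := ubnP (size s).
elim: n s => // n IH s /ltnSE sn.
have [[x xs hx]|irr] := pselect (exists2 x, x \in s & conv_hull [set` rem x s] x).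
  rewrite (conv_hull_redundant hx); apply: IH.
  by rewrite size_rem //; case: (s) xs sn .
have -> : vertices (conv_hull [set` s]) = [set` s]; last by split; [exact: finite_seq|].
apply/seteqP; split; first exact: vertices_conv_hull.
move=> x /= xs.
have /existsNP[u hu] : ~ forall u, exists2 y, y \in rem x s & dot y u <= dot x u.
  move=> h; apply: irr; exists x => //; apply/conv_hullP => //; exact: finite_seq.
have lt y : y \in rem x s -> dot x u < dot y u.
  by move=> ys; rewrite ltNge; apply/negP => yx; apply: hu; exists y.
apply: (@vertex_conv_hull _ _ u) => // y ys yx; apply: lt.
by move: ys; rewrite /= (perm_mem (perm_to_rem xs)) inE => /predU1P[].
Qed.

Lemma conv_hull_sub_polytope Q A : polytope Q -> A `<=` Q -> conv_hull A `<=` Q.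
Proof.
move=> [G finG ->] AG x hx; apply/conv_hullP => // u.
have [y Ay yx] := conv_hull_ge u hx.
have [z Gz zy] := conv_hull_ge u (AG y Ay).
by exists z => //; apply: le_trans yx.
Qed.

Lemma seq_argmin (T : eqType) (f : T -> R) (s : seq T) (x0 : T) : x0 \in s ->
  exists2 x : T, x \in s & forall y : T, y \in s -> f x <= f y.
Proof.
elim: s x0 => // a s IH x0 _; case: s IH => [_|b s IH].
  by exists a => [|y]; rewrite ?mem_head // inE => /eqP->.
have [x xs min] := IH b (mem_head _ _).
have [ax|/ltW xa] := leP (f a) (f x).
  exists a => [|y]; first exact: mem_head.
  by rewrite inE => /predU1P[->//|/min]; apply: le_trans.
exists x => [|y]; first by rewrite inE xs orbT.
by rewrite inE => /predU1P[->|/min].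
Qed.

Lemma polytope_min_vertex Q u x0 : polytope Q -> Q x0 ->
  exists2 v, vertices Q v & forall x, Q x -> dot v u <= dot x u.
Proof.
move=> polQ Qx0; have [/finite_seqP[s sE] QE] := polytope_vertices polQ.
have ge x : Q x -> exists2 y, y \in s & dot y u <= dot x u.
  by rewrite {1}QE => /conv_hull_ge-/(_ u)[y]; rewrite sE => ? ?; exists y.
have [y ys _] := ge _ Qx0.
have [v vs min] := seq_argmin (fun x => dot x u) ys.
exists v => [|x /ge[z zs]]; first by rewrite sE.
by apply: le_trans; apply: min.
Qed.

Lemma line_dim F a b : F a -> F b -> a <> b ->
  (forall x, F x -> exists r : R, x - a = r *: (b - a)) -> has_dim F 1.
Proof.
move=> Fa Fb ab H; exists (fun k => if k == ord0 then a else b).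
have E : diffs (fun k : 'I_2 => if k == ord0 then a else b) = b - a.
  by apply/rowP => i; rewrite /diffs !mxE.
split=> [k||x Fx]; first by case: ifP.
  rewrite /affinely_independent E /row_free rank_rV subr_eq0.
  by case: (eqVneq b a) ab => // ->.
by rewrite E eqxx; apply/sub_rVP; apply: H.
Qed.

Lemma dim1_line F v : has_dim F 1 -> F v ->
  exists q, (forall x, F x -> exists r : R, x - v = r *: q) /\ exists2 x, F x & x <> v.
Proof.
move=> [p [Fp ai H]] Fv; set q := diffs p in H ai.
have {}H x : F x -> exists r : R, x - p ord0 = r *: q by move=> /H/sub_rVP.
exists q; split=> [x Fx|].
  have [r rE] := H x Fx; have [s sE] := H v Fv; exists (r - s).
  by rewrite scalerBl -rE -sE opprB addrA subrK.
have [e|] := eqVneq (p ord0) v; last by exists (p ord0) => //; apply/eqP.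
exists (p (lift ord0 ord0)) => // e'.
move: ai; rewrite /affinely_independent -/q (_ : q = 0) /row_free ?mxrank0 //.
by apply/rowP => i; rewrite /q /diffs mxE [p (lift _ _)]e' e subrr.
Qed.

Lemma standard_simplexP (z : 'rV[R]_d) :
  standard_simplex z <-> (forall i, 0 <= z 0 i) /\ \sum_i z 0 i <= 1.
Proof.
split=> [hz|[z0 z1]].
  split=> [i|].
    have [x Ax] := conv_hull_ge (delta_mx i 0) hz; rewrite !dot_delta.
    by apply: le_trans; case: Ax => [->|[j _ <-]]; rewrite mxE ?ler0n.
  have dotE (x : 'rV[R]_d) : dot x (- const_mx 1) = - \sum_i x 0 i.
    by rewrite dotNr /dot mxE; under eq_bigr do rewrite mxE mulr1.
  have [x Ax] := conv_hull_ge (- const_mx 1) hz; rewrite !dotE lerN2 => le.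
  apply: (le_trans le); case: Ax => [->|[j _ <-]].
    by rewrite big1 // => i _; rewrite mxE.
  by rewrite (bigD1 j) //= big1 => [|i ij]; rewrite mxE ?eqxx ?addr0 // (negbTE ij) andbF.
(* The origin receives the weight left over by the unit vectors. *)
exists d.+1, (fun k => if unlift ord0 k is Some i then z 0 i else 1 - \sum_i z 0 i),
  (fun k => if unlift ord0 k is Some i then delta_mx 0 i else 0); split.
- by move=> k; case: unliftP => // _; rewrite subr_ge0.
- rewrite big_ord_recl unlift_none; under [X in _ + X]eq_bigr do rewrite liftK.
  by rewrite subrK.
- by move=> k; case: unliftP => [i _|_]; [right; exists i|left].
- rewrite big_ord_recl unlift_none scaler0 add0r [LHS]row_sum_delta.
  by apply: eq_bigr => i _; rewrite liftK.
Qed.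

End Hulls.

(** * Simplices and their barycenters *)

Section Simplices.
Variables (R : realType) (d : nat).
Implicit Types (A Q F E S : set 'rV[R]_d) (x y v w : 'rV[R]_d) (u : 'cV[R]_d).

Lemma int_num_ge1 (a : R) : a \is a Num.int -> 0 <= a -> a != 0 -> 1 <= a.
Proof. by move=> /intrP[m ->]; rewrite ler0z intr_eq0 ler1z; case: m => [[]|]. Qed.

(** For [d.+1] points the matrix of differences is square, hence invertible, so the increments of a
    form from [p ord0] can be prescribed. *)
Lemma affinely_independent_form (p : 'I_d.+1 -> 'rV[R]_d) (c : 'I_d -> R) :
  affinely_independent p ->
  exists u, forall i, dot (p (lift ord0 i)) u = dot (p ord0) u + c i.
Proof.
rewrite /affinely_independent row_free_unit => pu.
exists (invmx (diffs p) *m \col_i c i) => i; apply/eqP.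
rewrite addrC -subr_eq -dotBl; apply/eqP.
have -> : p (lift ord0 i) - p ord0 = row i (diffs p) by rewrite rowK.
by rewrite /dot mulmxA -row_mul mulmxV // -row_mul mul1mx !mxE.
Qed.

(** The increments from [p ord0] are chosen to be -1 at [k] and 0 elsewhere if [k] is not [ord0],
    and 1 everywhere if it is. *)
Lemma affinely_independent_expose (p : 'I_d.+1 -> 'rV[R]_d) k :
  affinely_independent p -> exists u, forall j, j != k -> dot (p k) u < dot (p j) u.
Proof.
move=> ai; case: (unliftP ord0 k) => [i ->|->].
  have [u hu] := affinely_independent_form (fun j => - (j == i)%:R) ai.
  exists u => j; case: (unliftP ord0 j) => [j' ->|-> _];
    rewrite !hu eqxx ?gtrDl ?oppr_lt0 //.
  by rewrite (inj_eq lift_inj) => /negbTE->; rewrite oppr0 addr0 gtrDl oppr_lt0.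
have [u hu] := affinely_independent_form (fun=> 1) ai.
exists u => j; case: (unliftP ord0 j) => [j' ->|->]; last by rewrite eqxx.
by rewrite hu ltrDl.
Qed.

Lemma affinely_independent_inj (p : 'I_d.+1 -> 'rV[R]_d) :
  affinely_independent p -> injective p.
Proof.
move=> ai i j pij; apply/eqP; apply: contrapT => /negP ij.
have [u /(_ _ ij)] := affinely_independent_expose j ai.
by rewrite pij ltxx.
Qed.

Lemma vertices_simplex (p : 'I_d.+1 -> 'rV[R]_d) :
  affinely_independent p -> vertices (conv_hull (range p)) = range p.
Proof.
move=> ai; apply/seteqP; split; first exact: vertices_conv_hull.
move=> _ [k _ <-]; have [u hu] := affinely_independent_expose k ai.
apply: (@vertex_conv_hull _ _ _ _ u); first by exists k.
by move=> _ [j _ <-] jk; apply: hu; apply: contra_notN jk => /eqP->.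
Qed.

Lemma barycenter_simplex (p : 'I_d.+1 -> 'rV[R]_d) : affinely_independent p ->
  barycenter (conv_hull (range p)) = d.+1%:R^-1 *: \sum_i p i.
Proof.
move=> ai; rewrite /barycenter vertices_simplex //.
have pe : perm_eq (fset_set (range p)) [seq p i | i <- enum 'I_d.+1].
  apply: uniq_perm; first exact: fset_uniq.
    by rewrite map_inj_uniq ?enum_uniq //; apply: affinely_independent_inj.
  move=> x; rewrite in_fset_set; last exact: finite_image.
  apply/idP/mapP => [|[i _ ->]]; last by rewrite inE; exists i.
  by rewrite inE => -[i _ <-]; exists i => //; rewrite mem_enum.
rewrite (perm_big _ pe) /= big_map big_enum /=; congr (_%:R^-1 *: _).
by rewrite (perm_size pe) size_map size_enum_ord.
Qed.

Lemma affinely_independent_nonconstant (p : 'I_d.+1 -> 'rV[R]_d) u :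
  affinely_independent p -> u != 0 -> exists k, dot (p k) u <> dot (p ord0) u.
Proof.
rewrite /affinely_independent row_free_unit => pu u0; apply: contrapT => no.
case/negP: u0; rewrite -[u](mulKmx pu) (_ : diffs p *m u = 0) ?mulmx0 //.
apply/colP => i; have -> : (diffs p *m u) i 0 = dot (p (lift ord0 i) - p ord0) u.
  by rewrite /dot !mxE; apply: eq_bigr => k _; rewrite !mxE.
rewrite dotBl; have -> : dot (p (lift ord0 i)) u = dot (p ord0) u.
  by apply: contrapT => h; apply: no; exists (lift ord0 i).
by rewrite subrr mxE.
Qed.

(* Affine independence keeps the nonnegative integers [dot (p i) u + c] from
   vanishing simultaneously. *)
Lemma barycenter_ge Q S u (c : R) : u != 0 ->
    (forall x, lattice x -> dot x u + c \is a Num.int) ->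
    (forall x, Q x -> 0 <= dot x u + c) ->
    d_simplex S -> vertices S `<=` Q `&` @lattice R d ->
  d.+1%:R^-1 <= dot (barycenter S) u + c.
Proof.
move=> u0 intu geu [p ai ->]; rewrite vertices_simplex // barycenter_simplex // => sP.
have QL i : (Q `&` @lattice R d) (p i) by apply: sP; exists i.
have geP i : 0 <= dot (p i) u + c by apply: geu; case: (QL i).
have latP i : dot (p i) u + c \is a Num.int by apply: intu; case: (QL i).
have d0 : (0 : R) < d.+1%:R by rewrite ltr0n.
rewrite -(ler_pM2l d0) mulfV ?gt_eqF // mulrDr dotZl mulrA mulfV ?gt_eqF // mul1r.
rewrite dot_suml mulr_natl -[X in c *+ X](card_ord d.+1) -sumr_const -big_split /=.
have [k kne] : exists k, dot (p k) u + c != 0.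
  have [k kne] := affinely_independent_nonconstant ai u0.
  have [e|] := eqVneq (dot (p k) u + c) 0; last by exists k.
  exists ord0; apply: contra_notN kne => /eqP e0.
  by apply: (addIr c); rewrite e e0.
rewrite (bigD1 k) //= -[X in X <= _]addr0 lerD ?sumr_ge0 //.
exact: int_num_ge1.
Qed.

End Simplices.

(** * Z-bases, dual coordinates and regular cones *)

Section Charts.
Variables (R : realType) (d : nat).
Implicit Types (Q F E S : set 'rV[R]_d) (x y v w : 'rV[R]_d) (u : 'cV[R]_d).
Implicit Types (A : 'M[int]_d) (i j : 'I_d).

(* The rows of a unimodular [A] form a Z-basis of the lattice, and the forms
   [crd A i] are its dual basis. *)
Definition bvec A i : 'rV[R]_d := row i (map_mx intr A).
Definition crd A i : 'cV[R]_d := col i (map_mx intr (invmx A)).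

Lemma dot_crd A y i : dot y (crd A i) = (y *m map_mx intr (invmx A)) 0 i.
Proof. by rewrite /dot !mxE; apply: eq_bigr => k _; rewrite !mxE. Qed.

Lemma dot_bvec A i j : A \in unitmx -> dot (bvec A i) (crd A j) = (i == j)%:R.
Proof.
move=> uA; rewrite dot_crd -row_mul -map_mxM mulmxV // map_mx1 !mxE.
by case: (i == j).
Qed.

Lemma bvec_expand A y : A \in unitmx -> y = \sum_i dot y (crd A i) *: bvec A i.
Proof.
move=> uA; under eq_bigr do rewrite dot_crd.
by rewrite -mulmx_sum_row -mulmxA -map_mxM mulVmx // map_mx1 mulmx1.
Qed.

Lemma crd_inj A x y : A \in unitmx ->
  (forall i, dot x (crd A i) = dot y (crd A i)) -> x = y.
Proof.
by move=> uA H; rewrite (bvec_expand x uA) (bvec_expand y uA);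
  apply: eq_bigr => i _; rewrite H.
Qed.

Lemma dot_expand A y u : A \in unitmx ->
  dot y u = \sum_i dot y (crd A i) * dot (bvec A i) u.
Proof.
move=> uA; rewrite {1}(bvec_expand y uA) dot_suml.
by apply: eq_bigr => i _; rewrite dotZl.
Qed.

Lemma bvec_inj A u (w : 'cV[R]_d) : A \in unitmx ->
  (forall i, dot (bvec A i) u = dot (bvec A i) w) -> u = w.
Proof.
move=> uA H.
have dotE y : dot y u = dot y w.
  by rewrite !(dot_expand _ _ uA); apply: eq_bigr => i _; rewrite H.
have rowE (c : 'cV[R]_d) i : c i 0 = dot (row i 1%:M) c.
  by rewrite /dot -row_mul mul1mx mxE.
by apply/colP => i; rewrite !rowE.
Qed.

Lemma crd_neq0 A i : A \in unitmx -> crd A i != 0.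
Proof.
move=> uA; apply/eqP => e; have := dot_bvec i i uA.
by rewrite e /dot mulmx0 mxE eqxx => /eqP; rewrite eq_sym oner_eq0.
Qed.

Lemma bvec_neq0 A i : A \in unitmx -> bvec A i != 0.
Proof.
move=> uA; apply/eqP => e; have := dot_bvec i i uA.
by rewrite e /dot mul0mx mxE eqxx => /eqP; rewrite eq_sym oner_eq0.
Qed.

Lemma lattice_bvec A i : lattice (bvec A i).
Proof. by exists (row i A) => //; rewrite /bvec /emb map_row. Qed.

Lemma latticeD x y : lattice x -> lattice y -> lattice (x + y).
Proof. by move=> [a _ <-] [b _ <-]; exists (a + b) => //; rewrite /emb map_mxD. Qed.

Lemma latticeB x y : lattice x -> lattice y -> lattice (x - y).
Proof. by move=> [a _ <-] [b _ <-]; exists (a - b) => //; rewrite /emb map_mxB. Qed.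

Lemma lattice_crd A i x : lattice x -> dot x (crd A i) \is a Num.int.
Proof.
by move=> [m _ <-]; rewrite dot_crd -map_mxM mxE; apply/intrP; eexists.
Qed.

Lemma cone_ge0 Q u : (forall x, Q x -> 0 <= dot x u) ->
  forall y, cone Q y -> 0 <= dot y u.
Proof.
move=> H _ [n [a [x [a0 Qx ->]]]]; rewrite dot_suml; apply: sumr_ge0 => i _.
by rewrite dotZl mulr_ge0 // H.
Qed.

Lemma sub_cone Q : Q `<=` cone Q.
Proof.
by move=> x Qx; exists 1%N, (fun=> 1), (fun=> x); split => //; rewrite big_ord1 scale1r.
Qed.

(** The ray is extremal: each dual coordinate other than the [i]-th sums to zero over nonnegative
    terms, so a generator with positive weight and positive [i]-th coordinate lies on the ray. *)
Lemma cone_ray n (a : 'I_n -> R) (x : 'I_n -> 'rV[R]_d) A i t : A \in unitmx ->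
    (forall k, 0 <= a k) -> (forall k j, 0 <= dot (x k) (crd A j)) -> 0 < t ->
    \sum_k a k *: x k = t *: bvec A i ->
  exists k t', 0 < t' /\ x k = t' *: bvec A i.
Proof.
move=> uA a0 x0 t0 E.
have Ej j : \sum_k a k * dot (x k) (crd A j) = t * (i == j)%:R.
  rewrite -(dot_bvec i j uA) -dotZl -E dot_suml.
  by apply: eq_bigr => k _; rewrite dotZl.
have [k kne] : exists k, a k * dot (x k) (crd A i) != 0.
  apply: contrapT => no; have := Ej i; rewrite big1 ?eqxx ?mulr1 => [e|k _].
    by move: t0; rewrite -e ltxx.
  by apply/eqP; apply: contrapT => /negP h; apply: no; exists k.
move: kne; rewrite mulf_eq0 negb_or => /andP[ak xk].
exists k, (dot (x k) (crd A i)); split; first by rewrite lt_def xk x0.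
apply: (crd_inj uA) => j; rewrite dotZl dot_bvec //.
have [<-|ij] := eqVneq i j; first by rewrite mulr1.
have s0 := Ej j; rewrite (negbTE ij) mulr0 in s0.
have /eqP : a k * dot (x k) (crd A j) = 0.
  by apply: (psumr_eq0P _ s0) => // l _; rewrite mulr_ge0.
by rewrite mulf_eq0 (negbTE ak) mulr0 => /eqP.
Qed.

(** The second hypothesis makes the cone full-dimensional: the dual form of a basis vector left out
    of [I] would vanish on it. *)
Lemma regular_cone_chart Q : regular_cone Q ->
    (forall u, u != 0 -> exists2 y, Q y & dot y u <> 0) ->
  exists2 A, A \in unitmx & forall y, Q y <-> forall i, 0 <= dot y (crd A i).
Proof.
move=> [b [I [bZ ->]]] full.
pose A : 'M[int]_d := \matrix_i b i.
(* The coordinates of the standard unit vectors in the basis [b] are the rows of an inverse of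
   [A]. *)
have /choice[f fE] : forall i, exists c : 'rV[int]_d, row i 1%:M = c *m A.
  move=> i; have [c [cE _]] := bZ (row i 1%:M); exists c; rewrite cE mulmx_sum_row.
  by apply: eq_bigr => j _; rewrite rowK.
have uA : A \in unitmx.
  have : (\matrix_i f i) *m A = 1%:M by apply/row_matrixP => i; rewrite row_mul rowK fE.
  by case/mulmx1_unit.
have bE i : emb R (b i) = bvec A i by rewrite /bvec -map_row rowK.
have II i : i \in I.
  have [y [n [a [x [_ Qx ->]]]]] := full _ (crd_neq0 i uA).
  apply: contra_notT => iI; rewrite dot_suml big1 // => k _.
  have [j /= jI <-] := Qx k; rewrite dotZl bE dot_bvec //.
  by case: eqVneq jI iI => [->->//|]; rewrite mulr0.
exists A => // y; split=> [Qy i|y0].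
  by apply: cone_ge0 Qy => _ [j _ <-]; rewrite bE dot_bvec // ler0n.
exists d, (fun i => dot y (crd A i)), (bvec A); split=> //; last exact: bvec_expand.
by move=> i; exists i => //=.
Qed.

End Charts.

(** * Charts and edges at a vertex of a smooth polytope *)

Section SmoothPolytope.
Variables (R : realType) (d : nat) (P : set 'rV[R]_d).
Hypotheses (latP : lattice_polytope P) (smoothP : smooth P).
Implicit Types (Q F E S : set 'rV[R]_d) (x y v w : 'rV[R]_d) (u : 'cV[R]_d).
Implicit Types (A : 'M[int]_d) (i j : 'I_d).

Let polP : polytope P. Proof. by case: latP. Qed.

(** The rows of [A] are the primitive generators of the feasible cone, which is recorded by its
    facet inequalities. *)
Definition chart Q v A := [/\ vertices Q v, A \in unitmx
  & forall y, fcone Q v y <-> forall i, 0 <= dot y (crd R A i)].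

(** As [P] has dimension [d], no nonzero form is constant on it, so none vanishes on the feasible
    cone. *)
Lemma vertex_chart v : vertices P v -> exists A, chart P v A.
Proof.
move=> vP; have [_ [p [Pp ai _]] reg] := smoothP.
have [u u0|A uA AP] := regular_cone_chart (reg v vP); last by exists A.
have [k kne] := affinely_independent_nonconstant ai u0.
have [x Px xne] : exists2 x, P x & dot x u <> dot v u.
  have [e|ne] := eqVneq (dot (p k) u) (dot v u); last by exists (p k) => //; apply/eqP.
  by exists (p ord0) => //; rewrite -e => /esym.
exists (x - v); first by apply: sub_cone; exists x.
by rewrite dotBl => /eqP; rewrite subr_eq0 => /eqP.
Qed.

Lemma vertex_lattice v : vertices P v -> lattice v.
Proof. by case: latP => _; apply. Qed.

Lemma chart_ge v A i x : chart P v A -> P x -> 0 <= dot (x - v) (crd R A i).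
Proof. by 
case=> _ _ AP Px; have /AP : fcone P v (x - v) by apply: sub_cone; exists x.
Qed.

(** Extremality of the ray is used twice: on the generators of the feasible cone, to find a point of
    [P] on the ray, and then on the vertices of which this point is a combination, to find a vertex
    on the ray. Its coordinate [t] is a positive integer, since both vertices are lattice points. *)
Lemma adjacent_vertex v A i : chart P v A ->
  exists w t, [/\ vertices P w, w = v + t *: bvec R A i & 1 <= t].
Proof.
move=> cA; have [vP uA AP] := cA.
have [n [a [x [a0 Qx E]]]] : fcone P v (bvec R A i).
  by apply/AP => j; rewrite dot_bvec // ler0n.
have [k [t [t0 xk]]] : exists k t, 0 < t /\ x k = t *: bvec R A i.
  apply: (cone_ray uA a0 _ ltr01); last by rewrite -E scale1r.
  by move=> k j; have [z Pz <-] := Qx k; apply: chart_ge.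
have [z Pz zE] := Qx k; move: xk; rewrite -zE => {}zE.
have [_ PE] := polytope_vertices polP.
have := Pz; rewrite {1}PE => -[m [b [w [b0 b1 Vw zE']]]].
have [l [s [s0 wE]]] : exists l s, 0 < s /\ w l - v = s *: bvec R A i.
  apply: (cone_ray uA b0 _ t0).
    by move=> l j; apply: chart_ge cA _; apply: vertex_sub (Vw l).
  rewrite -zE zE' -[in RHS](scale1r v) -b1 scaler_suml -sumrB.
  by apply: eq_bigr => l _; rewrite scalerBr.
exists (w l), s; split; [exact: Vw|by rewrite -wE addrC subrK|].
have sE : s = dot (w l - v) (crd R A i) by rewrite wE dotZl dot_bvec // eqxx mulr1.
apply: int_num_ge1; [|exact: ltW|by rewrite gt_eqF].
by rewrite sE; apply: lattice_crd; apply: latticeB; apply: vertex_lattice.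
Qed.

(** The point lies on the segment from [v] to the vertex found on the ray, because that vertex has
    [1 <= t]. *)
Lemma chart_step v A i : chart P v A -> P (v + bvec R A i).
Proof.
move=> cA; have [w [t [Vw wE t1]]] := adjacent_vertex i cA; have [Vv _ _] := cA.
have t0 : 0 < t by apply: lt_le_trans t1.
have -> : v + bvec R A i = (1 - t^-1) *: v + t^-1 *: w.
  by rewrite wE scalerDr scalerA mulVf ?gt_eqF // scale1r addrA -scalerDl subrK scale1r.
apply: polytope_convex polP _ _ _ _ _; rewrite ?subrK ?invr_ge0 ?(ltW t0) //.
- exact: vertex_sub.
- exact: vertex_sub.
- by rewrite subr_ge0 invf_le1.
Qed.

Lemma chart_sub v A : chart P v A -> P v.
Proof. by case=> /vertex_sub. Qed.

Definition ray_face v A i : set 'rV[R]_d :=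
  [set x | P x /\ exists r : R, x - v = r *: bvec R A i].

(** The dual forms are nonnegative on [P] relative to [v], so a sum of them vanishes only where each
    one does. This sum is the form that exposes the edge. *)
Lemma ray_faceP v A i x : chart P v A ->
  ray_face v A i x <-> P x /\ dot (x - v) (\sum_(j | j != i) crd R A j) = 0.
Proof.
move=> cA; have [_ uA _] := cA; split=> -[Px].
  move=> [r ->]; split => //; rewrite dot_sumr big1 // => j ji.
  by rewrite dotZl dot_bvec // eq_sym (negbTE ji) mulr0.
rewrite dot_sumr => s0; split=> //; exists (dot (x - v) (crd R A i)).
apply: (crd_inj uA) => j; rewrite dotZl dot_bvec //.
have [<-|ij] := eqVneq i j; first by rewrite mulr1.
by rewrite mulr0 (psumr_eq0P _ s0) // => [k _|]; [exact: chart_ge|rewrite eq_sym].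
Qed.

Lemma ray_face_edge v A i : chart P v A -> edge P (ray_face v A i).
Proof.
move=> cA; have [_ uA _] := cA; have Pv := chart_sub cA; split.
  have ge x : P x -> 0 <= dot (x - v) (\sum_(j | j != i) crd R A j).
    by move=> Px; rewrite dot_sumr; apply: sumr_ge0 => j _; apply: chart_ge.
  exists (\sum_(j | j != i) crd R A j); apply/seteqP; split=> x.
    move=> /(ray_faceP _ _ cA)[Px x0]; split=> // y /ge.
    by move/eqP: x0; rewrite !dotBl subr_ge0 subr_eq0 => /eqP<-.
  move=> [Px min]; apply/(ray_faceP _ _ cA); split=> //.
  by apply/eqP; rewrite eq_le ge // andbT dotBl subr_le0; apply: min.
apply: (@line_dim _ _ _ v (v + bvec R A i)).
- by split=> //; exists 0; rewrite subrr scale0r.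
- by split; [exact: chart_step|exists 1; rewrite addrC addKr scale1r].
- move/eqP; rewrite -subr_eq0 opprD addrA subrr sub0r oppr_eq0.
  by rewrite (negbTE (bvec_neq0 R i uA)).
- by move=> x [_ [r rE]]; exists r; rewrite [v + _]addrC addrK.
Qed.

(** The exposing form [u] is nonnegative on every generator. A second point of [E] has some nonzero
    [i]-th coordinate, which forces [u] to vanish on [bvec R A i]; so [E] contains [v + bvec R A i],
    and having dimension 1 it stays on that line. *)
Lemma edge_ray_face v A E : chart P v A -> edge P E -> E v ->
  exists i, E = ray_face v A i.
Proof.
move=> cA [[u EE] dimE] Ev; have [_ uA _] := cA.
have min y : P y -> dot v u <= dot y u by move: Ev; rewrite EE => -[_ /(_ y)].
have EP x : E x <-> P x /\ dot (x - v) u = 0.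
  rewrite EE; split=> -[Px h]; split=> //.
    by apply/eqP; rewrite dotBl subr_eq0 eq_le min // andbT; apply: h;
      apply: chart_sub cA.
  by move=> y Py; move/eqP: h; rewrite dotBl subr_eq0 => /eqP;
    rewrite /dot => ->; apply: min.
have bu j : 0 <= dot (bvec R A j) u.
  by have := min _ (chart_step j cA); rewrite dotDl lerDl.
have [q [Eq [x Ex xv]]] := dim1_line dimE Ev.
have [i xi] : exists i, dot (x - v) (crd R A i) != 0.
  apply: contrapT => no; apply: xv; apply/eqP; rewrite -subr_eq0; apply/eqP.
  apply: (crd_inj uA) => i; rewrite [RHS]/dot mul0mx mxE; apply/eqP.
  by apply: contrapT => /negP h; apply: no; exists i.
have [Px xu] := (EP x).1 Ex.
have bi : dot (bvec R A i) u = 0.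
  move: xu; rewrite {1}(bvec_expand (x - v) uA) dot_suml => /psumr_eq0P.
  move=> /(_ _ i isT) h; have /eqP : dot (dot (x - v) (crd R A i) *: bvec R A i) u = 0.
    by apply: h => j _; rewrite dotZl mulr_ge0 // chart_ge.
  by rewrite dotZl mulf_eq0 (negbTE xi) => /eqP.
have Ebi : E (v + bvec R A i).
  by apply/EP; split; [exact: chart_step|rewrite addrC addKr].
have [r] := Eq _ Ebi; rewrite addrC addKr => rE.
have r0 : r != 0.
  by apply/eqP => r0; have := bvec_neq0 R i uA; rewrite rE r0 scale0r eqxx.
exists i; apply/seteqP; split=> y.
  move=> Ey; have [s sE] := Eq _ Ey; split; first by case/EP: Ey.
  by exists (s / r); rewrite rE scalerA divfK.
move=> [Py [s sE]]; apply/EP; split=> //.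
by rewrite sE dotZl bi mulr0.
Qed.

(** * Corners and their barycenters *)

Local Notation B := (barycentric_hull P).
Local Notation C := (corner_barycenter P).

Definition corner_point v A (k : 'I_d.+1) : 'rV[R]_d :=
  if unlift ord0 k is Some i then v + bvec R A i else v.

Lemma corner_point0 v A : corner_point v A ord0 = v.
Proof. by rewrite /corner_point unlift_none. Qed.

Lemma corner_pointS v A i : corner_point v A (lift ord0 i) = v + bvec R A i.
Proof. by rewrite /corner_point liftK. Qed.

Lemma corner_point_independent v A :
  A \in unitmx -> affinely_independent (corner_point v A).
Proof.
move=> uA; apply/row_freeP; exists (map_mx intr (invmx A)).
rewrite (_ : diffs _ = map_mx intr A) -?map_mxM ?mulmxV ?map_mx1 //.
by apply/row_matrixP => i; rewrite rowK corner_point0 corner_pointS addrC addKr.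
Qed.

(** A lattice point other than [v] on the [i]-th edge is [v + r *: bvec R A i] with [r] a positive
    integer, so the nearest one has [r = 1]. *)
Lemma corner_simplex v A : chart P v A ->
  corner P v = conv_hull (range (corner_point v A)).
Proof.
move=> cA; have [Vv uA _] := cA; rewrite /corner; congr conv_hull.
apply/seteqP; split=> [x [->|[E [eE Ev [Ex Lx xv near]]]]|_ [k _ <-]].
- by exists ord0 => //; apply: corner_point0.
- have [i EE] := edge_ray_face cA eE Ev; subst E.
  have [Px [r rE]] := Ex; exists (lift ord0 i) => //; rewrite corner_pointS.
  have rD : r = dot (x - v) (crd R A i) by rewrite rE dotZl dot_bvec // eqxx mulr1.
  have r1 : 1 <= r.
    apply: int_num_ge1; rewrite rD.
    - by apply: lattice_crd; apply: latticeB => //; apply: vertex_lattice.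
    - exact: chart_ge.
    - rewrite -rD; apply: contra_notN xv => /eqP r0.
      by apply/eqP; rewrite -subr_eq0 rE r0 scale0r.
  have := near (v + bvec R A i); rewrite addrBl rE normrZ => h.
  have {}h : `|r| * `|bvec R A i| <= `|bvec R A i|.
    apply: h.
    - split; first exact: chart_step.
      by exists 1; rewrite addrBl scale1r.
    - by apply: latticeD; [exact: vertex_lattice|exact: lattice_bvec].
    - move/eqP; rewrite -subr_eq0 addrBl.
      by rewrite (negbTE (bvec_neq0 R i uA)).
  have r1' : r = 1.
    apply/eqP; rewrite eq_le r1 andbT.
    move: h; rewrite ger0_norm ?(le_trans ler01) // ger_pMl //.
    by rewrite normr_gt0 bvec_neq0.
  by rewrite -[RHS](subrK v) rE r1' scale1r addrC.
- case: (unliftP ord0 k) => [i ->|->]; last by left; rewrite corner_point0.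
  right; rewrite corner_pointS; exists (ray_face v A i); split.
  + exact: ray_face_edge.
  + by split; [exact: chart_sub cA|exists 0; rewrite subrr scale0r].
  split.
  + by split; [exact: chart_step|exists 1; rewrite addrBl scale1r].
  + by apply: latticeD; [exact: vertex_lattice|exact: lattice_bvec].
  + move/eqP; rewrite -subr_eq0 addrBl.
    by rewrite (negbTE (bvec_neq0 R i uA)).
  move=> w' [Pw' [r rE]] Lw' w'v; rewrite addrBl rE normrZ.
  have rD : r = dot (w' - v) (crd R A i) by rewrite rE dotZl dot_bvec // eqxx mulr1.
  have r1 : 1 <= r.
    apply: int_num_ge1; rewrite rD.
    - by apply: lattice_crd; apply: latticeB => //; apply: vertex_lattice.
    - exact: chart_ge.
    - rewrite -rD; apply: contra_notN w'v => /eqP r0.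
      by apply/eqP; rewrite -subr_eq0 rE r0 scale0r.
  by rewrite ler_peMl // ger0_norm // (le_trans ler01).
Qed.

Lemma corner_barycenterE v A : chart P v A ->
  C v = v + d.+1%:R^-1 *: \sum_i bvec R A i.
Proof.
move=> cA; have [_ uA _] := cA.
rewrite /corner_barycenter (corner_simplex cA) barycenter_simplex; last first.
  exact: corner_point_independent.
rewrite big_ord_recl corner_point0.
under eq_bigr do rewrite corner_pointS.
rewrite big_split /= sumr_const card_ord addrA -mulrS -[v *+ _]scaler_nat
  scalerDr scalerA.
by rewrite mulVf ?scale1r // pnatr_eq0.
Qed.

Lemma dot_corner_barycenter v A i : chart P v A ->
  dot (C v) (crd R A i) = dot v (crd R A i) + d.+1%:R^-1.
Proof.
move=> cA; have [_ uA _] := cA; rewrite (corner_barycenterE cA) dotDl dotZl.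
rewrite dot_suml (bigD1 i) //= dot_bvec // eqxx big1 ?addr0 ?mulr1 // => j ji.
by rewrite dot_bvec // (negbTE ji).
Qed.

Lemma corner_lattice_simplex v : vertices P v ->
  d_simplex (corner P v) /\ vertices (corner P v) `<=` P `&` @lattice R d.
Proof.
move=> Vv; have [A cA] := vertex_chart Vv; have [_ uA _] := cA.
rewrite (corner_simplex cA); have ai := corner_point_independent v uA; split.
  by exists (corner_point v A).
rewrite vertices_simplex // => _ [k _ <-].
case: (unliftP ord0 k) => [i ->|->]; rewrite ?corner_point0 ?corner_pointS; split.
- exact: chart_step.
- by apply: latticeD; [exact: vertex_lattice|exact: lattice_bvec].
- exact: vertex_sub.
- exact: vertex_lattice.
Qed.

(** * The barycentric hull as the hull of the corner barycenters *)

Lemma simplex_barycenter_ge v A S i : chart P v A -> d_simplex S ->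
  vertices S `<=` P `&` @lattice R d -> 0 <= dot (barycenter S - C v) (crd R A i).
Proof.
move=> cA sS SP; have [Vv uA _] := cA.
rewrite dotBl (dot_corner_barycenter _ cA) opprD addrA subr_ge0.
apply: (barycenter_ge _ _ _ sS SP); first exact: crd_neq0.
  move=> x Lx; rewrite -dotBl; apply: lattice_crd; apply: latticeB => //.
  exact: vertex_lattice.
by move=> x Px; rewrite -dotBl; apply: chart_ge.
Qed.

Lemma barycentric_hull_ge v A x i : chart P v A -> B x -> 0 <= dot (x - C v) (crd R A i).
Proof.
move=> cA Bx; have [_ [S [sS SP] <-] h] := conv_hull_ge (crd R A i) Bx.
have := simplex_barycenter_ge i cA sS SP; rewrite !dotBl !subr_ge0 => h'.
exact: le_trans h' h.
Qed.

Lemma finite_corner_barycenters : finite_set (C @` vertices P).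
Proof. by apply: finite_image; case: (polytope_vertices polP). Qed.

(** Given a form [u], let [v] be a vertex minimizing it on [P]. Then [u] is nonnegative on the
    generators at [v], and [barycenter S - C v] has nonnegative coordinates in them, so [C v] is a
    witness for the dual description. *)
Lemma barycentric_hullE : B = conv_hull (C @` vertices P).
Proof.
apply/seteqP; split=> x; last first.
  apply: conv_hull_mono => _ [v Vv <-]; exists (corner P v) => //.
  exact: corner_lattice_simplex.
move=> Bx; apply/conv_hullP; first exact: finite_corner_barycenters.
move=> u; have [_ [S [sS SP] <-] Sx] := conv_hull_ge u Bx.
have [_ [p [Pp _ _]] _] := smoothP.
have [v Vv min] := polytope_min_vertex u polP (Pp ord0).
have [A cA] := vertex_chart Vv; have [_ uA _] := cA.
exists (C v); first by exists v.
apply: le_trans Sx; rewrite -subr_ge0 -dotBl (dot_expand _ _ uA).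
apply: sumr_ge0 => i _; rewrite mulr_ge0 ?(simplex_barycenter_ge _ cA) //.
by have := min _ (chart_step i cA); rewrite dotDl lerDl.
Qed.

(* The points of the facet [dot (x - v) (crd R A j) = 0] at [v] affinely span its
   hyperplane, and a form [crd R A' k] occurring in the expansion of [crd R A j]
   vanishes on them, so the two forms are proportional; both are primitive. *)
Lemma chart_facet v A w A' j : chart P v A -> chart P w A' ->
  dot (w - v) (crd R A j) = 0 -> exists k, crd R A j = crd R A' k.
Proof.
move=> cA cA' wv; have [Vv uA _] := cA; have [Vw uA' _] := cA'.
set u := crd R A j in wv *; pose m k := dot (bvec R A' k) u.
have m0 k : 0 <= m k.
  have := chart_ge j cA (chart_step k cA').
  by rewrite addrAC dotDl wv add0r.
have [k mk] : exists k, m k != 0.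
  apply: contrapT => no; have := crd_neq0 R j uA; rewrite -/u.
  rewrite (_ : u = 0) ?eqxx //; apply: (bvec_inj uA') => k.
  rewrite [RHS]/dot mulmx0 mxE; apply/eqP.
  by apply: contrapT => /negP h; apply: no; exists k.
have Pfacet x : P x -> dot (x - v) u = 0 -> dot (x - w) (crd R A' k) = 0.
  move=> Px xv.
  have xw : \sum_l dot (x - w) (crd R A' l) * m l = 0.
    by rewrite -(dot_expand _ _ uA') (dot_sub_shift x w v) xv wv subrr.
  have /eqP : dot (x - w) (crd R A' k) * m k = 0.
    by apply: (psumr_eq0P _ xw) => // l _; rewrite mulr_ge0 ?(chart_ge _ cA').
  by rewrite mulf_eq0 (negbTE mk) orbF => /eqP.
pose c := dot (bvec R A j) (crd R A' k).
have cE : crd R A' k = c *: u.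
  apply: (bvec_inj uA) => q; rewrite dotZr dot_bvec //.
  have [->|qj] := eqVneq q j; first by rewrite mulr1.
  (* For [q] different from [j], both [v] and [v + bvec R A q] lie on the facet, so [crd R A' k]
     vanishes on their difference. *)
  have := Pfacet _ (chart_step q cA); rewrite addrBl dot_bvec // (negbTE qj).
  move=> /(_ erefl); rewrite addrAC dotDl Pfacet ?add0r ?mulr0 //.
    exact: chart_sub cA.
  by rewrite subrr /dot mul0mx mxE.
(* Both factors are values of dual forms at lattice vectors, hence integers; being positive with
   product 1, they equal 1. *)
have cm : c * m k = 1 by rewrite -dotZr -cE dot_bvec ?eqxx.
have mk1 : 1 <= m k by apply: int_num_ge1 => //; apply: lattice_crd; apply: lattice_bvec.
have c0 : 0 < c by rewrite -(pmulr_lgt0 _ (lt_le_trans ltr01 mk1)) cm.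
have c1 : 1 <= c.
  apply: int_num_ge1; [|exact: ltW|by rewrite gt_eqF].
  by apply: lattice_crd; apply: lattice_bvec.
exists k; rewrite cE (_ : c = 1) ?scale1r //.
by apply/eqP; rewrite eq_le c1 andbT -cm ler_peMr // ltW.
Qed.

(** The chart inequalities and the bound place [P] inside the corner simplex at [w]; conversely [P]
    contains [w] and all [w + bvec R A i], hence their hull. *)
Lemma unimodular_of_bound w A : chart P w A ->
  (forall x, P x -> \sum_i dot (x - w) (crd R A i) <= 1) -> unimodular_simplex P.
Proof.
move=> cA le1; have [Vw uA _] := cA; have [m _ mw] := vertex_lattice Vw.
exists A, m; split.
  have : (\det A == 1) || (\det A == -1) by rewrite unitmxE in uA.
  by case/orP => /eqP; [left|right].
rewrite mw; apply/seteqP; split=> [x Px|_ [z sz <-]].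
  exists ((x - w) *m map_mx intr (invmx A)); last first.
    by rewrite -mulmxA -map_mxM mulVmx // map_mx1 mulmx1 subrK.
  apply/standard_simplexP; split=> [i|]; first by rewrite -dot_crd chart_ge.
  by have := le1 x Px; under eq_bigr do rewrite dot_crd.
move: sz => [n [a [x [a0 a1 Ax ->]]]].
apply: (@conv_hull_sub_polytope _ _ P P polP) => //.
exists n, a, (fun k => x k *m map_mx intr A + w); split=> // [k|].
  have [->|[i _ <-]] := Ax k; first by rewrite mul0mx add0r; apply: chart_sub cA.
  by rewrite -rowE addrC; apply: chart_step.
rewrite mulmx_suml -[in LHS](scale1r w) -a1 scaler_suml -big_split /=.
by apply: eq_bigr => k _; rewrite scalerDr scalemxAl.
Qed.

(* [s] vanishes only if every corner point at [w] other than [w] lies on the facet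
   [dot (x - v) (crd R A i) = 0]; this facet then cuts the cone at [w] down to
   the corner at [w]. *)
Lemma corner_barycenter_shift v A w i t : chart P v A -> vertices P w ->
    w = v + t *: bvec R A i -> 0 < t ->
  exists s, [/\ 0 <= s, C w = C v + s *: bvec R A i
    & s = 0 -> unimodular_simplex P].
Proof.
move=> cA Vw wE t0; have [A' cA'] := vertex_chart Vw.
have [Vv uA _] := cA; have [_ uA' _] := cA'.
set u := crd R A i.
have wv j : dot (w - v) (crd R A j) = t * (i == j)%:R.
  by rewrite wE addrBl dotZl dot_bvec.
have t1 : 1 <= t.
  have tE : t = dot (w - v) u by rewrite wv eqxx mulr1.
  apply: int_num_ge1; [|exact: ltW|by rewrite gt_eqF].
  by rewrite tE; apply: lattice_crd; apply: latticeB; apply: vertex_lattice.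
exists (dot (C w - C v) u); split.
- by apply: (simplex_barycenter_ge _ cA); case: (corner_lattice_simplex Vw).
- apply: (crd_inj uA) => j; rewrite [RHS]dotDl [X in _ + X]dotZl dot_bvec //.
  have [<-|ij] := eqVneq i j; first by rewrite mulr1 dotBl addrC subrK.
  have wvj : dot (w - v) (crd R A j) = 0 by rewrite wv (negbTE ij) mulr0.
  have [k kE] := chart_facet cA cA' wvj.
  rewrite mulr0 addr0 (dot_corner_barycenter _ cA) kE (dot_corner_barycenter _ cA') -kE.
  by move/eqP: wvj; rewrite dotBl subr_eq0 => /eqP->.
move=> s0; apply: (unimodular_of_bound cA') => x Px.
pose e k := dot (w + bvec R A' k - v) u.
have e0 k : 0 <= e k by apply: chart_ge cA _; apply: chart_step cA'.
have eE k : e k = t + dot (bvec R A' k) u by rewrite /e addrAC dotDl wv eqxx mulr1.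
have d0 : d.+1%:R != 0 :> R by rewrite pnatr_eq0.
(* This is [d.+1] times the equality of [u] at [C w] and [C v], measured from [v]: the corner points
   at [w] contribute [t] and the [e k], while [C v] has value [d.+1%:R^-1]. With [1 <= t] and
   nonnegative [e k], it forces [t = 1] and every [e k = 0]. *)
have te : t + \sum_k e k = 1.
  under eq_bigr do rewrite eE.
  rewrite big_split /= sumr_const card_ord addrA -mulrS -mulr_natl.
  have wu : dot w u = dot v u + t.
    by have := wv i; rewrite eqxx mulr1 dotBl => <-; rewrite addrC subrK.
  move/eqP: s0; rewrite dotBl subr_eq0 (dot_corner_barycenter _ cA).
  rewrite (corner_barycenterE cA') dotDl dotZl dot_suml wu -addrA => /eqP/addrI.
  by move=> /(congr1 ( *%R d.+1%:R)); rewrite mulrDr mulrA mulfV // mul1r.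
have se0 : 0 <= \sum_k e k by apply: sumr_ge0.
have [t1E seE] : t = 1 /\ \sum_k e k = 0 by split; lra.
have bE k : dot (bvec R A' k) u = -1.
  have : e k = 0 by apply: (psumr_eq0P _ seE).
  by rewrite eE t1E; lra.
(* Since [u] drops by 1 along each generator at [w], its value at [x - v] is 1 minus the coordinate
   sum of [x - w], and it is nonnegative. *)
have := chart_ge i cA Px; have := dot_sub_shift x w v u.
rewrite wv eqxx mulr1 t1E (dot_expand _ _ uA').
under eq_bigr do rewrite bE mulrN1.
by rewrite sumrN -/u; lra.
Qed.

(** * The unimodular case and the vertices of the barycentric hull *)

Lemma exists_vertex : exists v, vertices P v.
Proof.
have [_ [p [Pp _ _]] _] := smoothP.
by have [v] := polytope_min_vertex 0 polP (Pp ord0); exists v.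
Qed.

(** The [d.+1] barycentric coordinates of [P] are nonnegative integers at its lattice points, so
    each is at least [d.+1%:R^-1] at the barycenter of a lattice simplex. They sum to 1, so all
    these bounds are equalities and determine the barycenter. *)
Lemma barycentric_hull_unimodular :
  unimodular_simplex P -> exists b : 'rV[R]_d, B = [set b].
Proof.
move=> [A [m [detA PE]]].
have uA : A \in unitmx by rewrite unitmxE; case: detA => ->; rewrite ?unitrN1 ?unitr1.
have Pstd x : P x -> (forall i, 0 <= dot (x - emb R m) (crd R A i)) /\
    \sum_i dot (x - emb R m) (crd R A i) <= 1.
  rewrite PE => -[z /standard_simplexP[z0 z1] <-].
  have zE i : dot (z *m map_mx intr A + emb R m - emb R m) (crd R A i) = z 0 i.
    by rewrite addrK dot_crd -mulmxA -map_mxM mulmxV // map_mx1 mulmx1.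
  by split=> [i|]; [rewrite zE|under eq_bigr do rewrite zE].
have Lm : @lattice R d (emb R m) by exists m.
have d0 : d.+1%:R != 0 :> R by rewrite pnatr_eq0.
have bary S i : d_simplex S -> vertices S `<=` P `&` @lattice R d ->
    dot (barycenter S - emb R m) (crd R A i) = d.+1%:R^-1.
  move=> sS SP; pose g j := dot (barycenter S - emb R m) (crd R A j) - d.+1%:R^-1.
  have g0 j : 0 <= g j.
    rewrite /g subr_ge0 dotBl; apply: (barycenter_ge (crd_neq0 R j uA) _ _ sS SP).
      by move=> x Lx; rewrite -dotBl; apply/lattice_crd/latticeB.
    by move=> x /Pstd[+ _]; rewrite -dotBl; apply.
  have sg : \sum_j g j = 0.
    apply/eqP; rewrite eq_le sumr_ge0 // andbT.
    (* The remaining barycentric coordinate, as a linear form plus a constant. *)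
    have dotE x : dot x (- \sum_j crd R A j) + (1 + \sum_j dot (emb R m) (crd R A j))
        = 1 - \sum_j dot (x - emb R m) (crd R A j).
      rewrite dotNr dot_sumr; under [in RHS]eq_bigr do rewrite dotBl.
      by rewrite sumrB; ring.
    have : d.+1%:R^-1 <= dot (barycenter S) (- \sum_j crd R A j)
        + (1 + \sum_j dot (emb R m) (crd R A j)).
      apply: (barycenter_ge _ _ _ sS SP).
      (* The form is nonzero because it takes the value -1 at [bvec R A i]. *)
      - apply/eqP => /(congr1 (dot (bvec R A i))); rewrite dotNr dot_sumr.
        rewrite (bigD1 i) //= dot_bvec // eqxx big1 => [|j ji].
          by rewrite addr0 /dot mulmx0 mxE => /eqP; rewrite oppr_eq0 oner_eq0.
        by rewrite dot_bvec // eq_sym (negbTE ji).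
      - move=> x Lx; rewrite dotE rpredB ?rpred1 //; apply: rpred_sum => j _.
        by apply/lattice_crd/latticeB.
      - by move=> x /Pstd[_]; rewrite dotE subr_ge0.
    rewrite dotE /g sumrB sumr_const card_ord -[_ *+ d]mulr_natl => h.
    have : d%:R * d.+1%:R^-1 + d.+1%:R^-1 = 1 :> R.
      by rewrite -[X in _ + X]mul1r -mulrDl -natr1 mulfV // natr1.
    move=> e; move: h; rewrite subr_le0 lerBrDr -lerBrDl => /le_trans; apply.
    by rewrite lerBlDr e.
  have : g i = 0 by apply: (psumr_eq0P _ sg).
  by move/eqP; rewrite subr_eq0 => /eqP.
have [v Vv] := exists_vertex; exists (C v).
have [sC CP] := corner_lattice_simplex Vv.
have baryE S : d_simplex S -> vertices S `<=` P `&` @lattice R d -> barycenter S = C v.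
  move=> sS SP; apply: (addIr (- emb R m)); apply: (crd_inj uA) => i.
  by rewrite bary // bary.
apply/seteqP; split=> [x [n [a [y [_ a1 Ay ->]]]]|_ ->].
  rewrite /= -[RHS]scale1r -a1 scaler_suml; apply: eq_bigr => k _.
  by have [S [sS SP] <-] := Ay k; rewrite baryE.
by apply: sub_conv_hull; exists (corner P v).
Qed.

Lemma corner_barycenter_hull v : vertices P v -> B (C v).
Proof. by move=> Vv; rewrite barycentric_hullE; apply: sub_conv_hull; exists v. Qed.

(** The sum of the dual forms at [v] exposes [C v]: relative to [C v] each of them is nonnegative on
    [B], and all vanish only at [C v]. *)
Lemma corner_barycenter_vertex v : vertices P v -> vertices B (C v).
Proof.
move=> Vv; have [A cA] := vertex_chart Vv; have [_ uA _] := cA.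
apply: (@expose_vertex _ _ _ _ (\sum_i crd R A i)); first exact: corner_barycenter_hull.
move=> x Bx xC; rewrite -subr_gt0 -dotBl dot_sumr.
have ge i : true -> 0 <= dot (x - C v) (crd R A i).
  by move=> _; apply: barycentric_hull_ge.
rewrite lt_def sumr_ge0 // andbT; apply/eqP => /(psumr_eq0P ge) x0.
apply: xC; apply/eqP; rewrite -subr_eq0; apply/eqP; apply: (crd_inj uA) => i.
by rewrite x0 // /dot mul0mx mxE.
Qed.

Lemma vertices_barycentric_hull : vertices B = C @` vertices P.
Proof.
apply/seteqP; split; first by rewrite barycentric_hullE; apply: vertices_conv_hull.
by move=> _ [v Vv <-]; apply: corner_barycenter_vertex.
Qed.

(** * Feasible cones, edges and smoothness when [P] is not a unimodular simplex *)

Section NonUnimodular.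
Hypothesis nonU : ~ unimodular_simplex P.

Lemma corner_barycenter_shift_gt0 v A w i t : chart P v A -> vertices P w ->
    w = v + t *: bvec R A i -> 0 < t ->
  exists2 s, 0 < s & C w = C v + s *: bvec R A i.
Proof.
move=> cA Vw wE t0; have [s [s0 CE sU]] := corner_barycenter_shift cA Vw wE t0.
by exists s => //; rewrite lt_def s0 andbT; apply/eqP => /sU.
Qed.

Lemma corner_barycenter_adjacent v A i : chart P v A ->
  exists w s, [/\ vertices P w, 0 < s & C w = C v + s *: bvec R A i].
Proof.
move=> cA; have [w [t [Vw wE t1]]] := adjacent_vertex i cA.
have [s s0 CE] := corner_barycenter_shift_gt0 cA Vw wE (lt_le_trans ltr01 t1).
by exists w, s.
Qed.

(** The dual forms at [v] are nonnegative on [B] relative to [C v], which gives one inclusion. For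
    the other, the corner barycenters of the neighbours of [v] lie at positive multiples of the
    generators from [C v]. *)
Lemma fcone_barycentric_hull v : vertices P v -> fcone P v = fcone B (C v).
Proof.
move=> Vv; have [A cA] := vertex_chart Vv; have [_ uA AP] := cA.
apply/seteqP; split=> y; last first.
  move=> hy; apply/AP => i; apply: cone_ge0 hy => _ [x Bx <-].
  exact: barycentric_hull_ge.
move=> /AP y0.
have /choice[f fP] : forall i, exists ws : 'rV[R]_d * R,
    [/\ vertices P ws.1, 0 < ws.2 & C ws.1 = C v + ws.2 *: bvec R A i].
  by move=> i; have [w [s ?]] := corner_barycenter_adjacent i cA; exists (w, s).
exists d, (fun i => dot y (crd R A i) / (f i).2), (fun i => C (f i).1 - C v); split.
- by move=> i; have [_ /ltW s0 _] := fP i; rewrite mulr_ge0 ?invr_ge0.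
- move=> i; have [Vw _ _] := fP i; exists (C (f i).1) => //.
  by rewrite barycentric_hullE; apply: sub_conv_hull; exists (f i).1.
- rewrite {1}(bvec_expand y uA); apply: eq_bigr => i _.
  by have [_ s0 ->] := fP i; rewrite addrBl scalerA divfK ?gt_eqF.
Qed.

(** If the barycenters agree, so do the feasible cones of [P] at [v] and [w]; this common cone
    contains both [v - w] and [w - v], and it is pointed. *)
Lemma corner_barycenter_inj v w :
  vertices P v -> vertices P w -> C v = C w -> v = w.
Proof.
move=> Vv Vw e; have [A cA] := vertex_chart Vv; have [_ uA AP] := cA.
have Pw : fcone P v (v - w).
  rewrite (fcone_barycentric_hull Vv) e -(fcone_barycentric_hull Vw).
  by apply: sub_cone; exists v => //; apply: vertex_sub.
apply: (crd_inj uA) => i; apply/eqP; rewrite eq_le -subr_ge0 -dotBl.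
rewrite (chart_ge _ cA) ?vertex_sub //=; last exact: vertex_sub.
by rewrite -subr_ge0 -dotBl; have /AP := Pw; apply.
Qed.

(** The edge leaves [v] along some generator [bvec R A i], so [C w - C v] is a positive multiple of
    it. The sum of the other dual forms at [v] exposes the edge of [B]: its zeros on [B] lie on the
    ray from [C v], and they stop at [C w]. *)
Lemma joined_corner_barycenters v w : vertices P v -> vertices P w -> joined P v w ->
  joined B (C v) (C w) /\ parallel (w - v) (C w - C v).
Proof.
move=> Vv Vw vw; have [A cA] := vertex_chart Vv; have [_ uA _] := cA.
have hv : conv_hull [set v; w] v by apply: sub_conv_hull; left.
have hw : conv_hull [set v; w] w by apply: sub_conv_hull; right.
have [i E] := edge_ray_face cA vw hv.
have [Pw [t tE]] : ray_face v A i w by rewrite -E.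
(* For [w = v] the hull would be a single point, which is not of dimension 1. *)
have wv : w <> v.
  move=> wv; have [_ [_ [x [n [a [y [_ a1 Ay ->]]]] xv]]] := dim1_line (proj2 vw) hv.
  apply: xv; rewrite -[RHS]scale1r -a1 scaler_suml; apply: eq_bigr => k _.
  by have [->|->] := Ay k; rewrite ?wv.
have t0 : 0 < t.
  rewrite lt_def; apply/andP; split.
    apply/eqP => t0; apply: wv; apply/eqP.
    by rewrite -subr_eq0 tE t0 scale0r.
  by have := chart_ge i cA Pw; rewrite tE dotZl dot_bvec // eqxx mulr1.
have wE : w = v + t *: bvec R A i by rewrite -tE addrC subrK.
have [s s0 CE] := corner_barycenter_shift_gt0 cA Vw wE t0.
have CvwE : C w - C v = s *: bvec R A i by rewrite CE addrBl.
split; last first.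
  exists (s / t); first by rewrite mulf_neq0 ?invr_eq0 ?gt_eqF.
  by rewrite CvwE tE scalerA divfK ?gt_eqF.
have polB : polytope B.
  by exists (C @` vertices P);
    [exact: finite_corner_barycenters|exact: barycentric_hullE].
have polS : polytope (conv_hull [set C v; C w]).
  by exists [set C v; C w] => //; apply: finite_set2.
have SB : conv_hull [set C v; C w] `<=` B.
  apply: conv_hull_sub_polytope => // _ [->|->]; exact: corner_barycenter_hull.
have line x : B x -> dot (x - C v) (\sum_(j | j != i) crd R A j) = 0 ->
    exists2 r, 0 <= r & x - C v = r *: bvec R A i.
  move=> Bx; rewrite dot_sumr => x0; exists (dot (x - C v) (crd R A i)).
    exact: barycentric_hull_ge.
  apply: (crd_inj uA) => j; rewrite [RHS]dotZl dot_bvec //.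
  have [<-|ij] := eqVneq i j; first by rewrite mulr1.
  rewrite mulr0 (psumr_eq0P _ x0) // => [k _|]; first exact: barycentric_hull_ge.
  by rewrite eq_sym.
have Cline : dot (C w - C v) (\sum_(j | j != i) crd R A j) = 0.
  rewrite CvwE dotZl dot_sumr big1 ?mulr0 // => j ji.
  by rewrite dot_bvec // eq_sym (negbTE ji).
have Bge x : B x -> 0 <= dot (x - C v) (\sum_(j | j != i) crd R A j).
  by move=> Bx; rewrite dot_sumr; apply: sumr_ge0 => j _; apply: barycentric_hull_ge.
have Sline x : conv_hull [set C v; C w] x ->
    dot (x - C v) (\sum_(j | j != i) crd R A j) = 0.
  move=> hx; have [y Ay yx] := conv_hull_ge (- \sum_(j | j != i) crd R A j) hx.
  apply/eqP; rewrite eq_le Bge ?andbT; last exact: SB.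
  move: yx; rewrite !dotNr lerN2 => yx; rewrite dotBl subr_le0.
  apply: (le_trans yx); case: Ay => ->//.
  by move/eqP: Cline; rewrite dotBl subr_eq0 => /eqP->.
split; last first.
  apply: (@line_dim _ _ _ (C v) (C w)).
  - by apply: sub_conv_hull; left.
  - by apply: sub_conv_hull; right.
  - by move=> /corner_barycenter_inj e; apply: wv; rewrite e.
  move=> x hx; have [r _ rE] := line x (SB x hx) (Sline x hx).
  by exists (r / s); rewrite rE CvwE scalerA divfK ?gt_eqF.
exists (\sum_(j | j != i) crd R A j); apply/seteqP; split=> x.
  move=> hx; split=> [|y By]; first exact: SB.
  have := Bge y By; rewrite dotBl subr_ge0; apply: le_trans.
  by have /eqP := Sline x hx; rewrite dotBl subr_eq0 => /eqP<-.
move=> [Bx min].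
have [|r r0 rE] := line x Bx.
  apply/eqP; rewrite eq_le Bge // andbT dotBl subr_le0; apply: min.
  exact: corner_barycenter_hull.
have rs : r <= s.
  (* If [x] lay beyond [C w], the pointed cone of [P] at [w] would contain [bvec R A i] and also,
     because of [v], its opposite. *)
  rewrite leNgt; apply/negP => sr; have [A' cA'] := vertex_chart Vw.
  have [_ uA' _] := cA'; have /eqP := bvec_neq0 R i uA; apply.
  apply: (crd_inj uA') => k; rewrite [RHS]/dot mul0mx mxE; apply/eqP; rewrite eq_le.
  have := chart_ge k cA' (chart_sub cA).
  rewrite -opprB tE -scaleNr dotZl nmulr_rge0 ?oppr_lt0 // => -> /=.
  have := barycentric_hull_ge k cA' Bx.
  rewrite (_ : x - C w = (r - s) *: bvec R A i).
    by rewrite dotZl pmulr_rge0 ?subr_gt0.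
  by rewrite scalerBl -rE -CvwE opprB addrA subrK.
have -> : x = (1 - r / s) *: C v + (r / s) *: C w.
  rewrite CE scalerDr scalerA divfK ?gt_eqF // addrA -scalerDl subrK scale1r -rE.
  by rewrite addrC subrK.
apply: polytope_convex polS _ _ _ _ _; rewrite ?subrK //.
- by apply: sub_conv_hull; left.
- by apply: sub_conv_hull; right.
- by rewrite subr_ge0 ler_pdivrMr // mul1r.
- by rewrite divr_ge0 // ltW.
Qed.

(** Regularity transfers through the equality of feasible cones. For the dimension, [C v] and its
    shifts along the [d] generators are affinely independent: their difference matrix is an
    invertible diagonal matrix times that of the generators. *)
Lemma smooth_barycentric_hull : smooth B.
Proof.
have [_ _ reg] := smoothP; split.
- by exists (C @` vertices P);
    [exact: finite_corner_barycenters|exact: barycentric_hullE].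
- have [v Vv] := exists_vertex; have [A cA] := vertex_chart Vv; have [_ uA _] := cA.
  have /choice[f fP] : forall i, exists ws : 'rV[R]_d * R,
      [/\ vertices P ws.1, 0 < ws.2 & C ws.1 = C v + ws.2 *: bvec R A i].
    by move=> i; have [w [s ?]] := corner_barycenter_adjacent i cA; exists (w, s).
  pose p k := if unlift ord0 k is Some i then C (f i).1 else C v.
  have p0 : p ord0 = C v by rewrite /p unlift_none.
  have free : row_free (diffs p).
    apply/row_freeP.
    exists (map_mx intr (invmx A) *m diag_mx (\row_i (f i).2^-1)).
    have -> : diffs p = diag_mx (\row_i (f i).2) *m map_mx intr A.
      apply/row_matrixP => i; rewrite rowK p0 /p liftK.
      have [_ _ ->] := fP i; rewrite addrBl mul_diag_mx.
      by apply/rowP => j; rewrite !mxE.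
    rewrite mulmxA -(mulmxA (diag_mx _)) -map_mxM mulmxV // map_mx1 mulmx1.
    rewrite mulmx_diag -diag_const_mx; congr diag_mx; apply/rowP => i; rewrite !mxE.
    by have [_ s0 _] := fP i; rewrite mulfV ?gt_eqF.
  exists p; split=> // [k|x _].
    rewrite /p; case: unliftP => [i _|_]; last exact: corner_barycenter_hull.
    by have [Vw _ _] := fP i; apply: corner_barycenter_hull.
  by apply: submx_full; rewrite row_full_unit -row_free_unit.
- rewrite vertices_barycentric_hull => _ [v Vv <-].
  by rewrite -fcone_barycentric_hull //; apply: reg.
Qed.

End NonUnimodular.

End SmoothPolytope.

Theorem theorem3p9 (R : realType) (d : nat) (P : set 'rV[R]_d)
    (latP : lattice_polytope P) (smoothP : smooth P) :
  let B := barycentric_hull P in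
  let C := corner_barycenter P in
  [/\ B = conv_hull [set C v | v in vertices P],
      unimodular_simplex P -> exists b : 'rV[R]_d, B = [set b]
    & ~ unimodular_simplex P ->
      [/\ set_bij (vertices P) (vertices B) C,
          forall v w, vertices P v -> vertices P w -> joined P v w ->
            joined B (C v) (C w) /\ parallel (w - v) (C w - C v),
          [set fcone P v | v in vertices P] = [set fcone B v | v in vertices B],
          forall v, vertices P v -> fcone P v = fcone B (C v)
        & smooth B]].
Proof.
move=> B C; split.
- exact: barycentric_hullE.
- exact: barycentric_hull_unimodular.
move=> nonU; have VB := vertices_barycentric_hull latP smoothP; split.
- split.
  + by move=> v Vv; apply: corner_barycenter_vertex.
  + by move=> v w; rewrite !inE => Vv Vw; apply: corner_barycenter_inj.
  + by move=> b; rewrite VB => -[v Vv <-]; exists v.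
- by move=> v w; apply: joined_corner_barycenters.
- rewrite VB; apply/seteqP; split=> [_ [v Vv <-]|_ [_ [v Vv <-] <-]].
    exists (C v); first by exists v.
    by rewrite [RHS](fcone_barycentric_hull latP smoothP nonU Vv).
  by exists v => //; apply: fcone_barycentric_hull.
- by move=> v; apply: fcone_barycentric_hull.
- exact: smooth_barycentric_hull.
Qed.
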